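(* **(1)** Let $(\mathfrak h,[\cdot,\cdot]_{\mathfrak h})$ be a finite-dimensional Lie algebra over $\mathbb F$, acting on $\mathfrak h^*$ through the coadjoint representation $\operatorname{ad}^*_{\mathfrak h}:\mathfrak h\to\mathfrak{gl}(\mathfrak h^* )$, let $\mathfrak a$ be a finite-dimensional trivial $\mathfrak h$-module, and let $\overline{\operatorname{ad}^*_{\mathfrak h}}:\mathfrak h\to\mathfrak{gl}(\operatorname{Hom}_{\mathbb F}(\mathfrak a,\mathfrak h^* ))$ be the representation $\overline{\operatorname{ad}^*_{\mathfrak h}}(x)(T)=\operatorname{ad}^*_{\mathfrak h}(x)\circ T$. Let $\varphi:\mathfrak h\to\operatorname{Hom}_{\mathbb F}(\mathfrak a,\mathfrak h^* )$ be a $1$-cocycle with coefficients in $\overline{\operatorname{ad}^*_{\mathfrak h}}$, let $e_\varphi:C(\mathfrak h;\mathfrak a)\to C(\mathfrak h;\mathfrak h^* )$ be the associated degree-one map, and let $D_\varphi$ be the map on $C(\mathfrak h;\mathfrak a)\oplus C(\mathfrak h;\mathfrak h^* )$ given by $$D_\varphi\begin{pmatrix}\lambda\\ \mu\end{pmatrix}=\begin{pmatrix}d\lambda\\ d\mu+e_\varphi(\lambda)\end{pmatrix}.$$ Given a $2$-cochain $\begin{pmatrix}\lambda\\ \mu\end{pmatrix}$, with $\lambda\in C^2(\mathfrak h;\mathfrak a)$ and $\mu\in C^2(\mathfrak h;\mathfrak h^* )$, define on $\mathfrak g=\mathfrak h\oplus\mathfrak a\oplus\mathfrak h^*$ the skew-symmetric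 bilinear map $[\cdot,\cdot]_{\{\lambda,\mu\}}:\mathfrak g\times\mathfrak g\to\mathfrak g$ by $$[x,y]_{\{\lambda,\mu\}}=[x,y]_{\mathfrak h}+\lambda(x,y)+\mu(x,y),\quad [x,v]_{\{\lambda,\mu\}}=\varphi(x)(v),\quad [x,\alpha]_{\{\lambda,\mu\}}=\operatorname{ad}^*_{\mathfrak h}(x)(\alpha),\quad [u+\alpha,v+\beta]_{\{\lambda,\mu\}}=0,$$ for $x,y\in\mathfrak h$, $u,v\in\mathfrak a$, $\alpha,\beta\in\mathfrak h^*$. Then $[\cdot,\cdot]_{\{\lambda,\mu\}}$ is a Lie bracket on $\mathfrak g$ if and only if $\begin{pmatrix}\lambda\\ \mu\end{pmatrix}\in\operatorname{Ker}D_\varphi$. **(2)** Let the data be as in (1), with $[\cdot,\cdot]_{\{\lambda,\mu\}}$ a Lie bracket on $\mathfrak g$. Let $B_{\mathfrak a}:\mathfrak a\times\mathfrak a\to\mathbb F$ be a symmetric non-degenerate bilinear form, and let $B:\mathfrak g\times\mathfrak g\to\mathbb F$ be the bilinear form $$B(x+u+\alpha,\,y+v+\beta)=\alpha(y)+\beta(x)+B_{\mathfrak a}(u,v),\qquad x,y\in\mathfrak h,\ u,v\in\mathfrak a,\ \alpha,\beta\in\mathfrak h^*.$$ Let $\varphi^*:\mathfrak h\to\operatorname{Hom}_{\mathbb F}(\mathfrak h,\mathfrak a^* )$ be the linear map $(\varphi^*(x)(y))(v)=(\varphi(x)(v))(y)$, and let $\lambda_\varphi:\mathfrak h\times\mathfrak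 h\to\mathfrak a$ be the bilinear map satisfying $\varphi^*(x)(y)=-B_{\mathfrak a}(\lambda_\varphi(x,y),\,\cdot\,)$ for all $x,y\in\mathfrak h$. If $(\mathfrak g,[\cdot,\cdot]_{\{\lambda,\mu\}},B)$ is a quadratic Lie algebra, then: (b1) $\mu(x,y)(z)=\mu(y,z)(x)$ for all $x,y,z\in\mathfrak h$; (b2) there exists a linear map $\tau:\mathfrak h\to\mathfrak a$ with $\tau\in\operatorname{Ker}(e_\varphi)$ such that $\lambda_\varphi=\lambda+d\tau$. Conversely, if (b1) and (b2) hold, then $(\mathfrak g,[\cdot,\cdot]_{\{\lambda,\mu\}})$ admits an invariant metric. Furthermore, any solvable non-Abelian quadratic Lie algebra $\mathfrak g$ having an Abelian descending central ideal is, up to an isomorphism preserving the invariant metrics, of the form $\mathfrak h\oplus\mathfrak a\oplus\mathfrak h^*$ for some Lie algebra $(\mathfrak h,[\cdot,\cdot]_{\mathfrak h})$ with $\mathfrak h\simeq\mathfrak g/\mathfrak j(\mathfrak g)$, some trivial $\mathfrak h$-module $\mathfrak a$ with a symmetric non-degenerate bilinear form $B_{\mathfrak a}$, some $1$-cocycle $\varphi:\mathfrak h\to\operatorname{Hom}_{\mathbb F}(\mathfrak a,\mathfrak h^* )$ with coefficients in $\overline{\operatorname{ad}^*_{\mathfrak h}}$, and some $\begin{pmatrix}\lambda\\ \mu\end{pmatrix}\in\operatorname{Ker}D_\varphi$ with $\lambda\in C^2(\mathfrak h;\mathfrak a)$ and $\mu\in C^2(\mathfrak h;\mathfrak h^*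 )$, with Lie bracket $$[x,y]=[x,y]_{\mathfrak h}+\lambda(x,y)+\mu(x,y),\quad [x,v]=\varphi(x)(v),\quad [x,\alpha]=\operatorname{ad}^*_{\mathfrak h}(x)(\alpha),\quad [u+\alpha,v+\beta]=0,$$ and invariant metric $B(x+u+\alpha,\,y+v+\beta)=\alpha(y)+\beta(x)+B_{\mathfrak a}(u,v)$, for $x,y\in\mathfrak h$, $u,v\in\mathfrak a$, $\alpha,\beta\in\mathfrak h^*$, where $\mathfrak h^*\simeq\mathfrak i(\mathfrak g)$, $\mathfrak a\oplus\mathfrak h^*\simeq\mathfrak j(\mathfrak g)$, and the pair $\{\lambda,\mu\}$ is given by the components along $\mathfrak a$ and $\mathfrak h^*$, respectively, of the Lie bracket in $\mathfrak g$ of any two elements of $\mathfrak h$.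
   Context: $\mathbb F$ is a field of characteristic zero; all Lie algebras and vector spaces are finite-dimensional over $\mathbb F$; $\mathbb N=\{1,2,\dots\}$. An invariant metric on a Lie algebra $\mathfrak g$ is a non-degenerate symmetric bilinear form $B$ with $B([x,y],z)=B(x,[y,z])$ for all $x,y,z$; a quadratic Lie algebra is a Lie algebra equipped with an invariant metric. For an $\mathfrak h$-module $M$, $C(\mathfrak h;M)=\bigoplus_n C^n(\mathfrak h;M)$ is the Chevalley--Eilenberg complex of alternating multilinear maps $\mathfrak h\times\cdots\times\mathfrak h\to M$, with differential $d$. Here $\mathfrak a$ is the trivial module, so $(d\tau)(x,y)=-\tau([x,y]_{\mathfrak h})$ for linear $\tau:\mathfrak h\to\mathfrak a$, and $\mathfrak h^*$ carries the coadjoint representation $\operatorname{ad}^*_{\mathfrak h}(x)(\alpha)=-\alpha\circ\operatorname{ad}_{\mathfrak h}(x)$. That $\varphi$ is a $1$-cocycle means $\varphi([x,y]_{\mathfrak h})=\operatorname{ad}^*_{\mathfrak h}(x)\circ\varphi(y)-\operatorname{ad}^*_{\mathfrak h}(y)\circ\varphi(x)$. The degree-one map $e_\varphi:C^n(\mathfrak h;\mathfrak a)\to C^{n+1}(\mathfrak h;\mathfrak h^* )$ is $$e_\varphi(\lambda)(x_1,\dots,x_{n+1})=\sum_{i=1}^{n+1}(-1)^{i+1}\varphi(x_i)\big(\lambda(x_1,\dots,\widehat{x_i},\dots,x_{n+1})\big).$$ Descending central series: $\mathfrak g^0=\mathfrak g$, $\mathfrak g^\ell=[\mathfrak g,\mathfrak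 g^{\ell-1}]$ for $\ell\in\mathbb N$. Derived central series: $C_1(\mathfrak g)=C(\mathfrak g)$ is the center, and $C_\ell(\mathfrak g)=\pi_{\ell-1}^{-1}\big(C(\mathfrak g/C_{\ell-1}(\mathfrak g))\big)$ for $\ell>1$, with $\pi_{\ell-1}:\mathfrak g\to\mathfrak g/C_{\ell-1}(\mathfrak g)$ the projection. $\mathfrak g$ has an Abelian descending central ideal if $[\mathfrak g^\ell,\mathfrak g^\ell]=\{0\}$ for some $\ell\in\mathbb N$. The canonical ideals are $$\mathfrak i(\mathfrak g)=\sum_{k\in\mathbb N}C_k(\mathfrak g)\cap\mathfrak g^k,\qquad \mathfrak j(\mathfrak g)=\bigcap_{k\in\mathbb N}\big(C_k(\mathfrak g)+\mathfrak g^k\big).$$ *)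

(* Defs.v *)
From HB Require Import structures.
From mathcomp Require Import all_boot all_order all_algebra.

Set Implicit Arguments.
Unset Strict Implicit.
Unset Printing Implicit Defensive.

Import GRing.Theory.
Local Open Scope ring_scope.

(* Finite-dimensional vector spaces are [vectType]s; the dual of [h] is        *)
(* ['Hom(h, F^o)], so that [alpha y : F] for [alpha] in the dual.              *)

Definition bilinear_map (F : fieldType) (U V W : lmodType F)
    (f : U -> V -> W) : Prop :=
  (forall v, linear (f ^~ v)) /\ (forall u, linear (f u)).

Section LieAlgebra.
Variables (F : fieldType) (g : vectType F).

Definition is_lie_bracket (br : g -> g -> g) : Prop :=
  [/\ bilinear_map br,
      forall x, br x x = 0
    & forall x y z, br x (br y z) + br y (br z x) + br z (br x y) = 0].

Definition nondeg_symmetric_form (B : g -> g -> F) : Prop :=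
  [/\ bilinear_map (B : g -> g -> F^o),
      forall x y, B x y = B y x
    & forall x, (forall y, B x y = 0) -> x = 0].

Definition invariant_metric (br : g -> g -> g) (B : g -> g -> F) : Prop :=
  nondeg_symmetric_form B /\ (forall x y z, B (br x y) z = B x (br y z)).

Definition quadratic_lie_algebra (br : g -> g -> g) (B : g -> g -> F) : Prop :=
  is_lie_bracket br /\ invariant_metric br B.

(* The center is the kernel of the adjoint map x |-> [x, -]; see [centerP].    *)
Definition center (br : g -> g -> g) : {vspace g} :=
  lker (linfun (fun x => linfun (br x))).

Lemma centerP (br : g -> g -> g) (x : g) : bilinear_map br ->
  x \in center br <-> forall y, br x y = 0.
Proof.
move=> [linl linr].
pose f2 u : {linear g -> g} :=
  HB.pack (br u) (GRing.isSemilinear.Build F g g _ (br u)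
    (GRing.semilinear_linear (linr u))).
have adE u v : linfun (br u) v = br u v by rewrite (lfunE (f2 u)).
have ad_lin : linear (fun u => linfun (br u)).
  by move=> c u v; apply/lfunP => w; rewrite add_lfunE scale_lfunE !adE linl.
pose f1 : {linear g -> 'Hom(g, g)} :=
  HB.pack (fun u => linfun (br u)) (GRing.isSemilinear.Build F g 'Hom(g, g) _
    (fun u => linfun (br u)) (GRing.semilinear_linear ad_lin)).
rewrite /center memv_ker (lfunE f1) /=; split.
  by move/eqP => x0 y; rewrite -adE x0 zero_lfunE.
by move=> x0; apply/eqP/lfunP => y; rewrite adE x0 zero_lfunE.
Qed.

(* [U, V] : the subspace spanned by the brackets (for a bilinear [br], those   *)
(* of basis vectors suffice, as for [prodv]).                                  *)
Definition brv (br : g -> g -> g) (U V : {vspace g}) : {vspace g} :=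
  <<[seq br u v | u <- vbasis U, v <- vbasis V]>>%VS.

Definition abelian_lie (br : g -> g -> g) : Prop := forall x y, br x y = 0.

Fixpoint derived_series (br : g -> g -> g) (l : nat) : {vspace g} :=
  if l is k.+1 then brv br (derived_series br k) (derived_series br k)
  else fullv.

Definition solvable_lie (br : g -> g -> g) : Prop :=
  exists l, derived_series br l = 0%VS.

(* g^l, starting at g^0 = g. *)
Fixpoint desc_central (br : g -> g -> g) (l : nat) : {vspace g} :=
  if l is k.+1 then brv br fullv (desc_central br k) else fullv.

Definition has_abelian_desc_central_ideal (br : g -> g -> g) : Prop :=
  exists l, (0 < l)%N /\
    brv br (desc_central br l) (desc_central br l) = 0%VS.

(* The quotient g / W is realized on the complement [W^C] of the subspace W;   *)
(* [quo_proj] is the projection along W (see [lker_quo_proj] and               *)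
(* [limg_quo_proj]), and [quo_bracket] the bracket it induces when W is an     *)
(* ideal.                                                                      *)
Definition quo (W : {vspace g}) : vectType F := subvs_of (W^C)%VS.

Definition quo_proj (W : {vspace g}) : 'Hom(g, quo W) :=
  (linfun (vsproj (W^C)) \o daddv_pi (W^C) W)%VF.

Definition quo_repr (W : {vspace g}) (p : quo W) : g := vsval p.

Definition quo_bracket (br : g -> g -> g) (W : {vspace g})
    (p q : quo W) : quo W := quo_proj W (br (quo_repr p) (quo_repr q)).

Lemma quo_reprK (W : {vspace g}) : cancel (@quo_repr W) (quo_proj W).
Proof.
move=> p; rewrite /quo_proj comp_lfunE lfunE /= daddv_pi_id ?vsvalK //.
  by rewrite capvC capv_compl.
exact: subvsP.
Qed.

Lemma lker_quo_proj (W : {vspace g}) : lker (quo_proj W) = W.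
Proof.
have dWC : (W^C :&: W = 0)%VS by rewrite capvC capv_compl.
have projE x : vsval (quo_proj W x) = daddv_pi (W^C) W x.
  by rewrite /quo_proj comp_lfunE lfunE /= vsprojK ?memv_pi.
have decomp x : daddv_pi (W^C) W x + daddv_pi W (W^C) x = x.
  by apply: daddv_pi_add; rewrite // addvC addv_complf memvf.
apply/vspaceP => x; rewrite memv_ker; apply/eqP/idP => [px0 | xW].
  by rewrite -(decomp x) -projE px0 /= add0r memv_pi.
apply: val_inj; rewrite /= projE.
have := decomp x; rewrite (daddv_pi_id (capv_compl W) xW).
by move/(canRL (addrK _)); rewrite subrr.
Qed.

Lemma limg_quo_proj (W : {vspace g}) : limg (quo_proj W) = fullv.
Proof.
apply/vspaceP => p; rewrite memvf; apply/idP.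
by rewrite -[p]quo_reprK memv_img ?memvf.
Qed.

End LieAlgebra.

(* C_l(g), with l >= 1; the value at l = 0 is a dummy.                         *)
Fixpoint der_central (F : fieldType) (g : vectType F) (br : g -> g -> g)
    (l : nat) : {vspace g} :=
  match l with
  | 0 => 0%VS
  | k.+1 =>
      if k is 0 then center br else
      (quo_proj (der_central br k) @^-1:
         center (quo_bracket br (W := der_central br k)))%VS
  end.

Section CanonicalIdeals.
Variables (F : fieldType) (g : vectType F) (br : g -> g -> g).

(* [I] is the sum over all k >= 1 of the C_k(g) \cap g^k: an element of this   *)
(* sum of infinitely many subspaces lies in some finite partial sum.           *)
Definition is_ideal_i (I : {vspace g}) : Prop :=
  forall x, x \in I <-> exists n,
    x \in (\sum_(1 <= k < n.+1) (der_central br k :&: desc_central br k))%VS.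

(* [J] is the intersection over all k >= 1 of the C_k(g) + g^k. *)
Definition is_ideal_j (J : {vspace g}) : Prop :=
  forall x, x \in J <-> forall k, (0 < k)%N ->
    x \in (der_central br k + desc_central br k)%VS.

End CanonicalIdeals.

Definition is_lie_iso (F : fieldType) (g g' : vectType F) (br : g -> g -> g)
    (br' : g' -> g' -> g') (f : 'Hom(g, g')) : Prop :=
  bijective f /\ (forall x y, f (br x y) = br' (f x) (f y)).

(* Chevalley-Eilenberg complex, in arbitrary degree n. Cochains are functions  *)
(* on n-tuples; [is_cochain] carves out the alternating multilinear ones.      *)
(* Indices start at 0, so the signs read (-1)^i instead of (-1)^(i+1).         *)
Section ChevalleyEilenberg.
Variables (F : fieldType) (h : vectType F) (br : h -> h -> h).

Definition set_tnth n (x : n.-tuple h) (i : 'I_n) (u : h) : n.-tuple h :=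
  [tuple if k == i then u else tnth x k | k < n].

Definition omit n (x : n.+1.-tuple h) (i : 'I_n.+1) : n.-tuple h :=
  [tuple tnth x (lift i k) | k < n].

(* ([x_i, x_j], x_0, .., ^x_i, .., ^x_j, .., x_n); used only for i < j, where  *)
(* the sequence has exactly n entries.                                         *)
Definition bracket_omit n (x : n.+1.-tuple h) (i j : 'I_n.+1) : n.-tuple h :=
  [tuple nth 0 (br (tnth x i) (tnth x j) ::
                 [seq tnth x k | k <- enum 'I_n.+1 & (k != i) && (k != j)]) m
  | m < n].

Definition is_cochain (M : vectType F) n (lam : n.-tuple h -> M) : Prop :=
  (forall x i, linear (fun u => lam (set_tnth x i u))) /\
  (forall x (i j : 'I_n), i != j -> tnth x i = tnth x j -> lam x = 0).

(* The differential for the h-module M with action [rho]. *)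
Definition ce_d (M : vectType F) (rho : h -> M -> M) n
    (lam : n.-tuple h -> M) : n.+1.-tuple h -> M :=
  fun x => \sum_(i < n.+1) (-1) ^+ i *: rho (tnth x i) (lam (omit x i)) +
    \sum_(i < n.+1) \sum_(j < n.+1 | (i < j)%N)
      (-1) ^+ (i + j) *: lam (bracket_omit x i j).

Definition triv_act (M : vectType F) (x : h) (m : M) : M := 0.

(* ad*(x)(alpha) = - alpha o ad(x) *)
Definition coad (x : h) : 'End('Hom(h, F^o)) :=
  linfun (fun al : 'Hom(h, F^o) => (- (al \o linfun (br x)))%VF).

Lemma coadE (x y : h) (al : 'Hom(h, F^o)) : bilinear_map br ->
  coad x al y = - al (br x y).
Proof.
move=> [_ linr].
have coad_lin : linear (fun be : 'Hom(h, F^o) => (- (be \o linfun (br x)))%VF).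
  move=> c u v; apply/lfunP => w.
  by rewrite !(add_lfunE, scale_lfunE, opp_lfunE, comp_lfunE) opprD scalerN.
pose f : {linear 'Hom(h, F^o) -> 'Hom(h, F^o)} :=
  HB.pack (fun be : 'Hom(h, F^o) => (- (be \o linfun (br x)))%VF)
    (GRing.isSemilinear.Build F 'Hom(h, F^o) 'Hom(h, F^o) _
      (fun be : 'Hom(h, F^o) => (- (be \o linfun (br x)))%VF)
      (GRing.semilinear_linear coad_lin)).
pose f2 : {linear h -> h} :=
  HB.pack (br x) (GRing.isSemilinear.Build F h h _ (br x)
    (GRing.semilinear_linear (linr x))).
by rewrite /coad (lfunE f) /= opp_lfunE comp_lfunE (lfunE f2).
Qed.

Variable a : vectType F.

(* The representation T |-> ad*(x) o T on Hom(a, h^* ). *)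
Definition coad_bar (x : h) (T : 'Hom(a, 'Hom(h, F^o))) :
  'Hom(a, 'Hom(h, F^o)) := (coad x \o T)%VF.

Definition is_1cocycle (phi : 'Hom(h, 'Hom(a, 'Hom(h, F^o)))) : Prop :=
  forall x y, phi (br x y) = coad_bar x (phi y) - coad_bar y (phi x).

Definition e_phi (phi : 'Hom(h, 'Hom(a, 'Hom(h, F^o)))) n
    (lam : n.-tuple h -> a) : n.+1.-tuple h -> 'Hom(h, F^o) :=
  fun x => \sum_(i < n.+1) (-1) ^+ i *: phi (tnth x i) (lam (omit x i)).

Definition D_phi (phi : 'Hom(h, 'Hom(a, 'Hom(h, F^o)))) n
    (c : (n.-tuple h -> a) * (n.-tuple h -> 'Hom(h, F^o))) :
    (n.+1.-tuple h -> a) * (n.+1.-tuple h -> 'Hom(h, F^o)) :=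
  (ce_d (@triv_act a) c.1,
   fun x => ce_d (fun y => coad y) c.2 x + e_phi phi c.1 x).

Definition in_Ker_D_phi (phi : 'Hom(h, 'Hom(a, 'Hom(h, F^o)))) n
    (lam : n.-tuple h -> a) (mu : n.-tuple h -> 'Hom(h, F^o)) : Prop :=
  [/\ is_cochain lam, is_cochain mu,
      (forall x, (D_phi phi (lam, mu)).1 x = 0)
    & (forall x, (D_phi phi (lam, mu)).2 x = 0)].

(* A linear map as a 1-cochain. *)
Definition cochain1 (M : vectType F) (tau : 'Hom(h, M)) : 1.-tuple h -> M :=
  fun x => tau (tnth x ord0).

Definition in_Ker_e_phi (phi : 'Hom(h, 'Hom(a, 'Hom(h, F^o)))) n
    (lam : n.-tuple h -> a) : Prop :=
  is_cochain lam /\ (forall x, e_phi phi lam x = 0).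

(* Elements of h + a + h^* are triples ((x, u), alpha). The bracket is the     *)
(* bilinear skew-symmetric extension of [x, y] = [x, y]_h + lam(x, y) +        *)
(* mu(x, y), [x, v] = phi(x)(v), [x, alpha] = ad*(x)(alpha) and                *)
(* [u + alpha, v + beta] = 0.                                                  *)
Definition ext_bracket (phi : 'Hom(h, 'Hom(a, 'Hom(h, F^o))))
    (lam : 2.-tuple h -> a) (mu : 2.-tuple h -> 'Hom(h, F^o))
    (p q : h * a * 'Hom(h, F^o)) : h * a * 'Hom(h, F^o) :=
  let: (x, u, al) := p in let: (y, v, be) := q in
  (br x y, lam [tuple x; y],
   mu [tuple x; y] + (phi x v - phi y u) + (coad x be - coad y al)).

Definition ext_form (Ba : a -> a -> F) (p q : h * a * 'Hom(h, F^o)) : F :=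
  let: (x, u, al) := p in let: (y, v, be) := q in al y + be x + Ba u v.

(* phi^*(x)(y)(v) = phi(x)(v)(y) *)
Definition phi_star (phi : 'Hom(h, 'Hom(a, 'Hom(h, F^o)))) (x y : h) (v : a) :
  F := phi x v y.

End ChevalleyEilenberg.

(* Main.v *)
From HB Require Import structures.
Require Import Defs.
From mathcomp Require Import all_boot all_order all_algebra.
From mathcomp Require Import ring.

Set Implicit Arguments.
Unset Strict Implicit.
Unset Printing Implicit Defensive.

Import GRing.Theory.
Local Open Scope ring_scope.

(** Part (1) is a direct computation. The Jacobi sum of the bracket of
    [h + a + h^*] at three vectors is additive in each of them; the terms that
    contain a vector of [a] cancel because [phi] is a cocycle, those that
    contain a vector of [h^*] cancel by the Jacobi identity of [h], and what
    remains has components [d lam] along [a] and [d mu + e_phi lam] along [h^*]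
    ([ext_jacobi2E], [is_lie_ext_bracketP]).

    In part (2), pairing [[x, y]] with [z] and with [v] in an invariant form
    gives the cyclicity of [mu] and [lam = lam_phi], so that [tau = 0] is a
    solution. Conversely [x + u + al |-> x + (u - tau x) + al] carries the
    bracket of [lam] to that of [lam_phi], and the invariant metric is the
    standard form pulled back along this map. Its invariance uses that the
    trilinear form [phi x (tau y) z] vanishes: it is symmetric in [x, y] and
    skew in [x, z] ([twisted_form_invariant]).

    For the last part the key is the duality [C_k(g) = (g^k)^perp]
    ([der_central_perp]). If [[g^l, g^l] = 0], invariance gives
    [g^(l+1) <= (g^l)^perp = C_l], and bracketing with [g] another [l] times
    shows that [g] is nilpotent. Taking orthogonals in the definition of [i(g)]
    gives [j(g) = i(g)^perp], and [i(g) <= j(g)] because both series are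
    monotone. Since the series [C_k] increases and [g^k] decreases, the
    modular law rewrites the intersection defining [j(g)] as the sum of the
    [C_(k+1) :&: g^k] ([ideal_jP]); as [[C_(k+1), g^k] = 0] by duality,
    [j(g)] is abelian.

    So [J = j(g)] is an abelian ideal with [J^perp <= J], and any such ideal
    yields the decomposition. The form identifies [J^perp] with the dual of
    [h = g / J]; a linear section of [g -> h] is corrected by elements of
    [J^perp] into an isotropic one, which is where [2] must be invertible; and
    [a] is the part of [J] orthogonal to the image of the section. The data
    [phi, lam, mu] are read off from the brackets. That the transported bracket
    is a Lie bracket forces the cocycle conditions ([is_1cocycle_ext] and
    part (1)). *)

(** * Linear and bilinear maps *)

Section LinearMaps.
Variables (F : fieldType) (U V W : vectType F).

Lemma linfunE (f : U -> V) : linear f -> forall x, linfun f x = f x.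
Proof.
move=> lin_f x.
pose f' : {linear U -> V} := HB.pack f
  (GRing.isSemilinear.Build F U V _ f (GRing.semilinear_linear lin_f)).
by rewrite (lfunE f').
Qed.

Variable f : U -> V -> W.
Hypothesis bf : bilinear_map f.

Lemma bilDl x y z : f (x + y) z = f x z + f y z.
Proof. by have := (proj1 bf) z 1 x y; rewrite !scale1r. Qed.

Lemma bilDr x y z : f x (y + z) = f x y + f x z.
Proof. by have := (proj2 bf) x 1 y z; rewrite !scale1r. Qed.

Lemma bil0l z : f 0 z = 0.
Proof. by apply: (addrI (f 0 z)); rewrite -bilDl !addr0. Qed.

Lemma bil0r x : f x 0 = 0.
Proof. by apply: (addrI (f x 0)); rewrite -bilDr !addr0. Qed.

Lemma bilZl c x z : f (c *: x) z = c *: f x z.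
Proof. by have := (proj1 bf) z c x 0; rewrite bil0l !addr0. Qed.

Lemma bilZr c x z : f x (c *: z) = c *: f x z.
Proof. by have := (proj2 bf) x c z 0; rewrite bil0r !addr0. Qed.

Lemma bilNl x z : f (- x) z = - f x z.
Proof. by rewrite -scaleN1r bilZl scaleN1r. Qed.

Lemma bilNr x z : f x (- z) = - f x z.
Proof. by rewrite -scaleN1r bilZr scaleN1r. Qed.

End LinearMaps.

Lemma alternating_skew (F : fieldType) (U W : vectType F) (f : U -> U -> W) :
  bilinear_map f -> (forall x, f x x = 0) -> forall x y, f x y = - f y x.
Proof.
move=> bf f0 x y; apply/eqP; rewrite -addr_eq0; apply/eqP.
by have := f0 (x + y); rewrite (bilDl bf) !(bilDr bf) !f0 add0r addr0.
Qed.

(** * Cochains, differential and e_phi in low degree *)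

Section Cochain2.
Variables (F : fieldType) (h M : vectType F).

Lemma tuple2E (x : 2.-tuple h) : x = [tuple tnth x ord0; tnth x ord_max].
Proof.
apply: eq_from_tnth => i; rewrite [in RHS](tnth_nth 0) /=.
by case: i => [[|[|//]] lti]; congr tnth; apply: val_inj.
Qed.

Definition alternating_bilinear (f : h -> h -> M) :=
  bilinear_map f /\ forall x, f x x = 0.

Lemma cochain2P (c : 2.-tuple h -> M) :
  is_cochain c <-> alternating_bilinear (fun x y => c [tuple x; y]).
Proof.
have set0 x y u : set_tnth [tuple x; y] ord0 u = [tuple u; y].
  by apply: eq_from_tnth => i; rewrite tnth_mktuple; case: i => [[|[|//]] lti].
have set1 x y u : set_tnth [tuple x; y] ord_max u = [tuple x; u].
  by apply: eq_from_tnth => i; rewrite tnth_mktuple; case: i => [[|[|//]] lti].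
split=> [[lin_c alt_c]|[[linl linr] alt]].
  split; last by move=> x; apply: (alt_c _ ord0 ord_max).
  split=> [y|x] k u v.
    by have := lin_c [tuple 0; y] ord0 k u v; rewrite !set0.
  by have := lin_c [tuple x; 0] ord_max k u v; rewrite !set1.
split=> [x i k u v|x i j].
  rewrite (tuple2E x); have [->|->]: i = ord0 \/ i = ord_max.
    by case: i => [[|[|//]] lti]; [left | right]; apply: val_inj.
  - by rewrite !set0 linl.
  by rewrite !set1 linr.
rewrite (tuple2E x); case: i => [[|[|//]] lti]; case: j => [[|[|//]] ltj] //= _.
  by rewrite !(tnth_nth 0) /= => ->.
by rewrite !(tnth_nth 0) /= => ->.
Qed.

End Cochain2.

Section LowDegree.
Variables (F : fieldType) (h : vectType F).

Lemma omit2 (x y : h) :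
  (omit [tuple x; y] ord0 = [tuple y]) *
  (omit [tuple x; y] (lift ord0 ord0) = [tuple x]).
Proof.
split; apply: eq_from_tnth => i; rewrite tnth_mktuple !(tnth_nth 0) /=;
  by case: i => [[|//] lti].
Qed.

Lemma omit3 (x y z : h) :
  (omit [tuple x; y; z] ord0 = [tuple y; z]) *
  (omit [tuple x; y; z] (lift ord0 ord0) = [tuple x; z]) *
  (omit [tuple x; y; z] (lift ord0 (lift ord0 ord0)) = [tuple x; y]).
Proof.
by (do ?split); apply: eq_from_tnth => i; rewrite tnth_mktuple !(tnth_nth 0) /=;
  case: i => [[|[|//]] lti].
Qed.

Variables (M : vectType F) (br : h -> h -> h).

Lemma bracket_omit2 (x y : h) :
  bracket_omit br [tuple x; y] ord0 (lift ord0 ord0) = [tuple br x y].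
Proof.
apply: eq_from_tnth => i; rewrite tnth_mktuple !(tnth_nth 0).
by case: i => [[|//] lti].
Qed.

Lemma bracket_omit3 (x y z : h) :
  let t := [tuple x; y; z] in
  let i0 := ord0 in let i1 := lift ord0 ord0 in
  let i2 := lift ord0 (lift ord0 ord0) in
  [/\ bracket_omit br t i0 i1 = [tuple br x y; z],
      bracket_omit br t i0 i2 = [tuple br x z; y] &
      bracket_omit br t i1 i2 = [tuple br y z; x]].
Proof.
by split; apply: eq_from_tnth => i;
  rewrite tnth_mktuple !enum_ordSl /= !(tnth_nth 0);
  case: i => [[|[|//]] lti].
Qed.

Lemma ce_d_deg1 rho (c : 1.-tuple h -> M) x y :
  ce_d br rho c [tuple x; y] =
    rho x (c [tuple y]) - rho y (c [tuple x]) - c [tuple br x y].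
Proof.
rewrite /ce_d !big_ord_recl !big_ord0 /=.
do 2![rewrite big_mkcond !big_ord_recl !big_ord0 /=].
rewrite !omit2 bracket_omit2 !(tnth_nth 0) /=.
by rewrite !(expr0, expr1, add0r, addr0, scale1r, scaleN1r).
Qed.

Lemma ce_d_deg2 rho (c : 2.-tuple h -> M) x y z :
  ce_d br rho c [tuple x; y; z] =
    rho x (c [tuple y; z]) - rho y (c [tuple x; z]) + rho z (c [tuple x; y])
    + (- c [tuple br x y; z] + c [tuple br x z; y] - c [tuple br y z; x]).
Proof.
have [b01 b02 b12] := bracket_omit3 x y z.
rewrite /ce_d !big_ord_recl !big_ord0 /=.
do 3![rewrite big_mkcond !big_ord_recl !big_ord0 /=].
rewrite !omit3 b01 b02 b12 !(tnth_nth 0) /= /bump /= !addn0 !add0n.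
rewrite !(expr0, expr1, sqrrN, expr1n, add0r, addr0, scale1r, scaleN1r).
by rewrite (exprD _ 1 2) expr1 sqrrN expr1n mulr1 scaleN1r !addrA.
Qed.

Variables (a : vectType F) (phi : 'Hom(h, 'Hom(a, 'Hom(h, F^o)))).

Lemma e_phi_deg1 (c : 1.-tuple h -> a) x y :
  e_phi phi c [tuple x; y] = phi x (c [tuple y]) - phi y (c [tuple x]).
Proof.
rewrite /e_phi !big_ord_recl !big_ord0 /= !omit2 !(tnth_nth 0) /=.
by rewrite !(expr0, expr1, addr0, scale1r, scaleN1r).
Qed.

Lemma e_phi_deg2 (c : 2.-tuple h -> a) x y z :
  e_phi phi c [tuple x; y; z] =
  phi x (c [tuple y; z]) - phi y (c [tuple x; z]) + phi z (c [tuple x; y]).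
Proof.
rewrite /e_phi !big_ord_recl !big_ord0 /= !omit3 !(tnth_nth 0) /= /bump /=.
by rewrite !(expr0, expr1, sqrrN, expr1n, addr0, scale1r, scaleN1r) addrA.
Qed.

End LowDegree.

(** * The bracket on h + a + h^* and the kernel of D_phi *)

Section Extension.
Variables (F : fieldType) (h a : vectType F) (brh : h -> h -> h).
Variables (phi : 'Hom(h, 'Hom(a, 'Hom(h, F^o)))).
Variables (lam : 2.-tuple h -> a) (mu : 2.-tuple h -> 'Hom(h, F^o)).
Hypothesis lie_h : is_lie_bracket brh.
Hypotheses (cochain_lam : is_cochain lam) (cochain_mu : is_cochain mu).

Local Notation ext := (ext_bracket brh phi lam mu).
Local Notation L x y := (lam [tuple x; y]).
Local Notation M x y := (mu [tuple x; y]).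

Let bil_h : bilinear_map brh. Proof. by case: lie_h. Qed.
Let alt_h x : brh x x = 0. Proof. by case: lie_h. Qed.
Let bil_lam : bilinear_map (fun x y => L x y).
Proof. by have /cochain2P[] := cochain_lam. Qed.
Let bil_mu : bilinear_map (fun x y => M x y).
Proof. by have /cochain2P[] := cochain_mu. Qed.
Let skew_h x y : brh x y = - brh y x. Proof. exact: alternating_skew. Qed.
Let skew_lam x y : L x y = - L y x.
Proof.
by have /cochain2P[bl al] := cochain_lam; apply: (alternating_skew bl al).
Qed.
Let skew_mu x y : M x y = - M y x.
Proof.
by have /cochain2P[bl al] := cochain_mu; apply: (alternating_skew bl al).
Qed.

Lemma triple_eq (p q : h * a * 'Hom(h, F^o)) :
  p.1.1 = q.1.1 -> p.1.2 = q.1.2 -> (forall t, p.2 t = q.2 t) -> p = q.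
Proof.
by case: p q => [[x u] al] [[y v] be] /= -> -> eq2; congr (_, _); apply/lfunP.
Qed.

Lemma ext_bracket2E p q t :
  (ext p q).2 t = M p.1.1 q.1.1 t + (phi p.1.1 q.1.2 t - phi q.1.1 p.1.2 t)
     + (- q.2 (brh p.1.1 t) + p.2 (brh q.1.1 t)).
Proof.
case: p q => [[x u] al] [[y v] be] /=.
by rewrite !(add_lfunE, opp_lfunE) !coadE // opprK.
Qed.

Lemma ext_bracket1E p q :
  (ext p q).1 = (brh p.1.1 q.1.1, L p.1.1 q.1.1).
Proof. by case: p q => [[x u] al] [[y v] be]. Qed.

Lemma ext_bracket_bilinear_alternating :
  bilinear_map ext /\ forall p, ext p p = 0.
Proof.
have skew p q : ext p q = - ext q p.
  apply: triple_eq => [||t] /=; rewrite ?ext_bracket1E /=.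
  - exact: skew_h.
  - exact: skew_lam.
  rewrite opp_lfunE !ext_bracket2E skew_mu opp_lfunE; ring.
have linr p : linear (ext p).
  move=> k q r; apply: triple_eq => [||t]; rewrite /= ?ext_bracket1E /=.
  - by rewrite (bilDr bil_h) (bilZr bil_h).
  - by rewrite (bilDr bil_lam) (bilZr bil_lam).
  rewrite add_lfunE scale_lfunE !ext_bracket2E /=.
  rewrite (bilDr bil_mu) (bilZr bil_mu) (bilDl bil_h) (bilZl bil_h) !linearP /=.
  rewrite !(add_lfunE, scale_lfunE) /GRing.scale /= linearP /=.
  rewrite /GRing.scale /=; ring.
split=> [|p].
  split=> // q k p r; rewrite skew linr [ext q p]skew [ext q r]skew.
  by rewrite scalerN -opprD opprK.
apply: triple_eq => [||t]; rewrite /= ?ext_bracket1E /=; first exact: alt_h.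
  by have /cochain2P[_] := cochain_lam; apply.
have /cochain2P[_ /(_ p.1.1) mu0] := cochain_mu.
rewrite ext_bracket2E mu0 zero_lfunE; ring.
Qed.

Lemma coboundary_lamE x y z :
  ce_d brh (@triv_act F h a) lam [tuple x; y; z] =
  L x (brh y z) + L y (brh z x) + L z (brh x y).
Proof.
rewrite ce_d_deg2 /triv_act subrr !add0r [brh z x]skew_h (bilNr bil_lam).
rewrite [L (brh x y) _]skew_lam [L (brh x z) _]skew_lam [L (brh y z) _]skew_lam.
by rewrite !opprK [LHS]addrC [X in _ + X = _]addrC addrA.
Qed.

(** Skew-symmetry moves the brackets to the second arguments, which turns the
    signed sums of the complex into the cyclic sums of a Jacobi identity. *)
Lemma D_phi_muE x y z t :
  (D_phi brh phi (lam, mu)).2 [tuple x; y; z] t =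
    M x (brh y z) t + M y (brh z x) t + M z (brh x y) t +
    (phi x (L y z) t + phi y (L z x) t + phi z (L x y) t) -
    (M y z (brh x t) + M z x (brh y t) + M x y (brh z t)).
Proof.
rewrite /D_phi /= ce_d_deg2 e_phi_deg2 [brh z x]skew_h (bilNr bil_mu).
rewrite [M (brh x y) _]skew_mu [M (brh x z) _]skew_mu [M (brh y z) _]skew_mu.
rewrite [L z x]skew_lam [M z x]skew_mu [phi y (- _)]linearN.
rewrite !(add_lfunE, opp_lfunE) !coadE //; ring.
Qed.

Lemma is_1cocycleP :
  is_1cocycle brh phi <->
  forall x y v t, phi (brh x y) v t = phi x v (brh y t) - phi y v (brh x t).
Proof.
have coad_barE x (T : 'Hom(a, 'Hom(h, F^o))) v t :
    coad_bar brh x T v t = - T v (brh x t).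
  by rewrite comp_lfunE coadE.
split=> [phiP x y v t|phiP x y].
  by rewrite phiP !(add_lfunE, opp_lfunE) !coad_barE opprK addrC.
apply/lfunP => v; apply/lfunP => t.
by rewrite phiP !(add_lfunE, opp_lfunE) !coad_barE opprK addrC.
Qed.

(** Only the [h]-components of the three vectors survive: the cocycle identity
    rewrites [phi [x, y] w] so that the terms in [a] cancel pairwise, and the
    Jacobi identity of [h], which makes [coad] a representation, cancels those
    in [h^*]. *)
Lemma ext_jacobi2E p q r t : is_1cocycle brh phi ->
  (ext p (ext q r) + ext q (ext r p) + ext r (ext p q)).2 t =
  (D_phi brh phi (lam, mu)).2 [tuple p.1.1; q.1.1; r.1.1] t.
Proof.
move=> /is_1cocycleP phiP; rewrite D_phi_muE !add_lfunE.
rewrite !ext_bracket2E !ext_bracket1E /= !phiP.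
case: p q r => [[x u] al] [[y v] be] [[z w] ga] /=.
have jacE x1 x2 x3 :
    brh (brh x1 x2) x3 = brh x1 (brh x2 x3) - brh x2 (brh x1 x3).
  case: lie_h => _ _ /(_ x1 x2 x3).
  rewrite [brh x3 (brh _ _)]skew_h [brh x3 x1]skew_h (bilNr bil_h).
  by move/eqP; rewrite subr_eq0 => /eqP.
rewrite !jacE !raddfB /=; ring.
Qed.

Lemma is_lie_ext_bracketP : is_1cocycle brh phi ->
  is_lie_bracket ext <-> in_Ker_D_phi brh phi lam mu.
Proof.
move=> phiP; have [bil_ext alt_ext] := ext_bracket_bilinear_alternating.
have tuple3E (x : 3.-tuple h) : exists y z t, x = [tuple y; z; t].
  exists (tnth x ord0), (tnth x (lift ord0 ord0)).
  exists (tnth x (lift ord0 (lift ord0 ord0))).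
  apply: eq_from_tnth => i; rewrite [in RHS](tnth_nth 0) /=.
  by case: i => [[|[|[|//]]] lti]; congr tnth; apply: val_inj.
split=> [[_ _ jac]|[_ _ dlam dmu]].
  split=> // t; have [x [y [z ->]]] := tuple3E t.
    have /(congr1 (fun p => p.1.2)) := jac (x, 0, 0) (y, 0, 0) (z, 0, 0).
    by rewrite /= coboundary_lamE.
  apply/lfunP => s.
  by rewrite -(ext_jacobi2E (x, 0, 0) (y, 0, 0) (z, 0, 0)) // jac !zero_lfunE.
split=> // p q r; apply: triple_eq => [||t] /=.
- by rewrite !ext_bracket1E /=; case: lie_h => _ _; apply.
- have := dlam [tuple p.1.1; q.1.1; r.1.1].
  by rewrite !ext_bracket1E /= coboundary_lamE.
- by rewrite (ext_jacobi2E _ _ _ _ phiP) dmu !zero_lfunE.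
Qed.

(** The cocycle identity is the Jacobi identity at two vectors of [h] and one
    of [a]. *)
Lemma is_1cocycle_ext : is_lie_bracket ext -> is_1cocycle brh phi.
Proof.
move=> [_ _ jac]; apply/is_1cocycleP => x y v t.
(* X, Y, V are kept opaque so that simplification does not unfold [ext]. *)
have [X defX] : exists X : h * a * 'Hom(h, F^o), X = (x, 0, 0) by eexists.
have [Y defY] : exists Y : h * a * 'Hom(h, F^o), Y = (y, 0, 0) by eexists.
have [V defV] : exists V : h * a * 'Hom(h, F^o), V = (0, v, 0) by eexists.
have : (ext X (ext Y V) + ext Y (ext V X) + ext V (ext X Y)).2 t = 0.
  by rewrite jac zero_lfunE.
rewrite !add_lfunE !ext_bracket2E !ext_bracket1E defX defY defV /=.
rewrite !(bil0l bil_h, bil0r bil_h) !(bil0l bil_mu, bil0r bil_mu).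
rewrite !(bil0l bil_lam, bil0r bil_lam) !(raddf0, zero_lfunE) => E.
apply/eqP; rewrite -subr_eq0 -[X in _ == X]oppr0 -[X in _ == - X]E.
by apply/eqP; ring.
Qed.

End Extension.

(** * Invariant metrics on the extension *)

Lemma functional_separates (F : fieldType) (V : vectType F) (x : V) :
  (forall f : 'Hom(V, F^o), f x = 0) -> x = 0.
Proof.
move=> x0; rewrite [x](coord_vbasis (memvf x)); apply: big1 => i _.
have lin_c : linear (coord (vbasis {:V}) i : V -> F^o).
  by move=> k u v; rewrite linearP.
by rewrite -(linfunE lin_c) x0 scale0r.
Qed.

Section Metric.
Variables (F : fieldType) (char0 : [pchar F] =i pred0).
Variables (h a : vectType F) (brh : h -> h -> h).
Variables (phi : 'Hom(h, 'Hom(a, 'Hom(h, F^o)))).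
Variables (lam : 2.-tuple h -> a) (mu : 2.-tuple h -> 'Hom(h, F^o)).
Variables (Ba : a -> a -> F) (lam_phi : h -> h -> a).
Hypothesis lie_h : is_lie_bracket brh.
Hypotheses (cochain_lam : is_cochain lam) (cochain_mu : is_cochain mu).
Hypothesis Ba_form : nondeg_symmetric_form Ba.
Hypothesis lam_phiE : forall x y v, phi_star phi x y v = - Ba (lam_phi x y) v.

Local Notation ext := (ext_bracket brh phi lam mu).
Local Notation L x y := (lam [tuple x; y]).
Local Notation M x y := (mu [tuple x; y]).

Let bil_h : bilinear_map brh. Proof. by case: lie_h. Qed.
Let bil_Ba : bilinear_map (Ba : a -> a -> F^o). Proof. by case: Ba_form. Qed.
Let bil_lam : bilinear_map (fun x y => L x y).
Proof. by have /cochain2P[] := cochain_lam. Qed.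
Let bil_mu : bilinear_map (fun x y => M x y).
Proof. by have /cochain2P[] := cochain_mu. Qed.
Let skew_h x y : brh x y = - brh y x.
Proof. by case: lie_h => bl al _; apply: (alternating_skew bl al). Qed.
Let skew_lam x y : L x y = - L y x.
Proof.
by have /cochain2P[bl al] := cochain_lam; apply: (alternating_skew bl al).
Qed.

Lemma ext_formE (p q : h * a * 'Hom(h, F^o)) :
  ext_form Ba p q = p.2 q.1.1 + q.2 p.1.1 + Ba p.1.2 q.1.2.
Proof. by case: p q => [[x u] al] [[y v] be]. Qed.

Let Ba_nondeg_eq u u' : (forall v, Ba u v = Ba u' v) -> u = u'.
Proof.
move=> eq_uu'; apply/eqP; rewrite -subr_eq0; apply/eqP.
case: Ba_form => _ _; apply=> v.
by rewrite (bilDl bil_Ba) (bilNl bil_Ba) eq_uu' subrr.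
Qed.

Let phiE x v y : phi x v y = - Ba (lam_phi x y) v.
Proof. exact: lam_phiE. Qed.

(** Invariance at two vectors [y, x] of [h] and one vector [v] of [a] reads
    [Ba (lam y x) v = phi x v y]. *)
Lemma lam_phi_of_invariant :
  (forall p q r, ext_form Ba (ext p q) r = ext_form Ba p (ext q r)) ->
  forall x y, lam_phi x y = L x y.
Proof.
move=> invB x y; apply: Ba_nondeg_eq => v.
have := invB (y, 0, 0) (x, 0, 0) (0, v, 0).
rewrite !ext_formE !ext_bracket1E !ext_bracket2E //= !(linear0, zero_lfunE).
rewrite !(bil0r bil_lam, bil0r bil_mu) !(bil0l bil_Ba) !(linear0, zero_lfunE).
rewrite !add0r !addr0 phiE skew_lam (bilNl bil_Ba) => /eqP.
by rewrite eqr_opp => /eqP.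
Qed.

Lemma mu_cyclic_of_invariant :
  (forall p q r, ext_form Ba (ext p q) r = ext_form Ba p (ext q r)) ->
  forall x y z, M x y z = M y z x.
Proof.
move=> invB x y z; have := invB (x, 0, 0) (y, 0, 0) (z, 0, 0).
rewrite !ext_formE !ext_bracket1E !ext_bracket2E //=.
rewrite !(bil0l bil_Ba, bil0r bil_Ba).
by rewrite !(linear0, zero_lfunE, subr0, addr0, add0r).
Qed.

Variable tau : 'Hom(h, a).

(** The pullback of [ext_form] along [x + u + al |-> x + (u - tau x) + al], an
    isomorphism from the bracket of [lam] onto that of [lam_phi] as soon as
    [tau] is in the kernel of [e_phi] and [lam_phi = lam + d tau]. *)
Definition twisted_form (p q : h * a * 'Hom(h, F^o)) : F :=
  ext_form Ba (p.1.1, p.1.2 - tau p.1.1, p.2) (q.1.1, q.1.2 - tau q.1.1, q.2).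

Lemma twisted_form_nondeg : nondeg_symmetric_form twisted_form.
Proof.
have [_ symBa nondegBa] := Ba_form.
have sym p q : twisted_form p q = twisted_form q p.
  by rewrite /twisted_form !ext_formE /= symBa [p.2 _ + _]addrC.
have linr p : linear (twisted_form p : _ -> F^o).
  move=> k q r; rewrite /twisted_form !ext_formE /= !linearP /=.
  rewrite add_lfunE scale_lfunE.
  rewrite [X in Ba _ X]addrACA -[in LHS]scalerDr.
  by rewrite (proj2 bil_Ba) /GRing.scale /=; ring.
split=> //.
  by split=> // q k p r; rewrite sym linr ![twisted_form q _]sym.
move=> [[x u] al] p0.
have x0 : x = 0.
  apply: functional_separates => f; have := p0 (0, 0, f).
  rewrite /twisted_form ext_formE /= !linear0 !(add0r, addr0).
  by rewrite (bil0r bil_Ba) addr0.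
have u0 : u = 0.
  apply: nondegBa => v; have := p0 (0, v, 0).
  by rewrite /twisted_form ext_formE /= x0 !linear0 !(subr0, addr0) !add0r.
have al0 : al = 0.
  apply/lfunP => y; have := p0 (y, 0, 0).
  rewrite /twisted_form ext_formE /= x0 u0 !linear0 !(subr0, addr0).
  by rewrite (bil0l bil_Ba) !addr0 zero_lfunE.
by rewrite x0 u0 al0.
Qed.

(** The pullback shifts the [a]-component of a bracket to [lam_phi x y], whose
    pairing with [w - tau z] is [- phi x (w - tau z) y]. The correction
    [phi x (tau z) y] drops out, and the invariance reduces to the
    cyclicity of [mu] and the skew-symmetry of [phi x v y] in [x] and [y]. *)
Lemma twisted_form_invariant :
  (forall x y z, M x y z = M y z x) ->
  (forall x y, phi x (tau y) = phi y (tau x)) ->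
  (forall x y, lam_phi x y = L x y - tau (brh x y)) ->
  forall p q r, twisted_form (ext p q) r = twisted_form p (ext q r).
Proof.
move=> mu_cyc tauP lam_tau.
have lam_skew x y : lam_phi x y = - lam_phi y x.
  by rewrite !lam_tau skew_lam skew_h linearN opprB opprK addrC.
have phi_skew x v y : phi x v y = - phi y v x.
  by rewrite !phiE lam_skew (bilNl bil_Ba).
(* Symmetric in x, y and skew in x, z, hence equal to its opposite. *)
have phi_tau x y z : phi x (tau y) z = 0.
  have : phi x (tau y) z = - phi x (tau y) z.
    by rewrite {1}tauP phi_skew tauP phi_skew tauP phi_skew opprK.
  move/eqP; rewrite -addr_eq0 -mulr2n -mulr_natr mulf_eq0 => /orP[/eqP//|].
  by rewrite ((pcharf0P F).1 char0).
have BaE x y z w : Ba (lam_phi x y) (w - tau z) = - phi x w y.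
  by rewrite -[LHS]opprK -phiE linearB add_lfunE opp_lfunE phi_tau subr0.
have symBa : forall u v, Ba u v = Ba v u by case: Ba_form.
move=> p q r; rewrite /twisted_form !ext_formE !ext_bracket1E /= -!lam_tau.
rewrite !BaE symBa BaE !ext_bracket2E //.
rewrite [phi q.1.1 p.1.2 _]phi_skew [phi r.1.1 q.1.2 _]phi_skew
  [phi q.1.1 r.1.2 _]phi_skew mu_cyc.
rewrite [brh r.1.1 _]skew_h [brh q.1.1 p.1.1]skew_h !linearN /=; ring.
Qed.

End Metric.

(** * Orthogonal subspaces of a non-degenerate form *)

Section Perp.
Variables (F : fieldType) (g : vectType F) (B : g -> g -> F).

Definition flat : 'Hom(g, 'Hom(g, F^o)) :=
  linfun (fun x => linfun (B x : g -> F^o)).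

(** The kernel of [x |-> B x (projv U _)]; as the projection is onto [U], these
    are the [x] orthogonal to [U]. *)
Definition perp (U : {vspace g}) : {vspace g} :=
  lker (linfun (fun x => (flat x \o projv U)%VF)).

Hypothesis formB : nondeg_symmetric_form B.
Let bilB : bilinear_map (B : g -> g -> F^o). Proof. by case: formB. Qed.
Let symB x y : B x y = B y x. Proof. by case: formB. Qed.

Lemma flatE x y : flat x y = B x y.
Proof.
have linB u : linear (B u : g -> F^o) by exact: (proj2 bilB).
rewrite /flat linfunE ?linfunE // => k u v; apply/lfunP => w.
by rewrite add_lfunE scale_lfunE !linfunE //; have := (proj1 bilB) w k u v.
Qed.

Lemma flat_surj (f : 'Hom(g, F^o)) : f \in limg flat.
Proof.
have ker0 : lker flat = 0%VS.
  apply/eqP; rewrite -subv0; apply/subvP => x; rewrite memv_ker => /eqP x0.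
  rewrite memv0; apply/eqP; case: formB => _ _; apply=> y.
  by rewrite -flatE x0 zero_lfunE.
suff -> : limg flat = fullv by rewrite memvf.
apply/eqP; rewrite eqEdim subvf /= dimvf.
by have := limg_ker_dim flat fullv; rewrite ker0 capv0 dimv0 add0n dimvf => ->;
  rewrite /dim /= muln1.
Qed.

Definition sharp (f : 'Hom(g, F^o)) : g := (flat^-1)%VF f.

Lemma sharpE f y : B (sharp f) y = f y.
Proof. by rewrite -flatE /sharp limg_lfunVK ?flat_surj. Qed.

Lemma perpP (U : {vspace g}) x :
  reflect (forall u, u \in U -> B x u = 0) (x \in perp U).
Proof.
have lin_p : linear (fun y => (flat y \o projv U)%VF).
  by move=> k u v; rewrite linearP comp_lfunDl comp_lfunZl.
rewrite memv_ker linfunE //; apply: (iffP eqP) => [x0 u uU|x0].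
  by rewrite -flatE -(projv_id uU) -comp_lfunE x0 zero_lfunE.
by apply/lfunP => y; rewrite comp_lfunE flatE zero_lfunE x0 // memv_proj.
Qed.

Lemma perpS U V : (U <= V)%VS -> (perp V <= perp U)%VS.
Proof.
move=> /subvP UV; apply/subvP => x /perpP xV.
by apply/perpP => u /UV; apply: xV.
Qed.

(** If the component of [x] off [U] were non-zero, a functional vanishing on [U]
    would detect it; that functional is represented by a vector of [perp U], to
    which [x] is orthogonal. *)
Lemma perpK U : perp (perp U) = U.
Proof.
apply/eqP; rewrite eqEsubv; apply/andP; split; apply/subvP => x; last first.
  by move=> xU; apply/perpP => u /perpP u0; rewrite symB u0.
move/perpP => x0; suff -> : x = projv U x by rewrite memv_proj.
apply/eqP; rewrite -subr_eq0; apply/eqP/functional_separates => f.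
pose k := (f \o (\1 - projv U))%VF.
have kE y : k y = f (y - projv U y).
  by rewrite comp_lfunE add_lfunE opp_lfunE id_lfunE.
rewrite -kE -sharpE symB x0 //; apply/perpP => u uU.
by rewrite sharpE kE projv_id // subrr linear0.
Qed.

Lemma perp_cap U V : perp (U :&: V) = (perp U + perp V)%VS.
Proof.
apply: (can_inj perpK); rewrite perpK; apply/eqP; rewrite eqEsubv.
apply/andP; split; last first.
  rewrite subv_cap -[X in (_ <= X)%VS && _](perpK U).
  by rewrite -[X in _ && (_ <= X)%VS](perpK V) !perpS ?addvSl ?addvSr.
apply/subvP => x; rewrite memv_cap => /andP[xU xV].
apply/perpP => _ /memv_addP[u uU [v vV ->]].
move: uU vV => /perpP uU /perpP vV.
by rewrite (bilDr bilB) ![B x _]symB uU // vV // addr0.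
Qed.

End Perp.

(** * Ideals, quotients and the central series *)

Lemma subv_sum_nat (F : fieldType) (g : vectType F) n
    (U : nat -> {vspace g}) V :
  (forall k, (0 < k)%N -> (k <= n)%N -> (U k <= V)%VS) ->
  (\sum_(1 <= k < n.+1) U k <= V)%VS.
Proof.
move=> UV; rewrite big_seq; elim/big_rec: _ => [|k W]; first exact: sub0v.
by rewrite mem_index_iota subv_add => /andP[k0 kn] ->; rewrite UV.
Qed.

Section Brackets.
Variables (F : fieldType) (g : vectType F) (br : g -> g -> g).
Hypothesis lie_br : is_lie_bracket br.
Let bil_br : bilinear_map br. Proof. by case: lie_br. Qed.
Let skew_br x y : br x y = - br y x.
Proof. by case: lie_br => bl al _; apply: (alternating_skew bl al). Qed.

Lemma memv_brv (U V : {vspace g}) u v :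
  u \in U -> v \in V -> br u v \in brv br U V.
Proof.
have mem_l x (lx : linear (br x)) (W Z : {vspace g}) :
    (forall y, y \in vbasis W -> br x y \in Z) ->
    forall y, y \in W -> br x y \in Z.
  move=> WZ y yW; rewrite -(linfunE lx) memv_preim; apply/subvP: y yW.
  rewrite -(span_basis (vbasisP W)); apply/span_subvP => y yW.
  by rewrite -memv_preim linfunE // WZ.
have lin_br x : linear (br x) by exact: (proj2 bil_br).
move=> uU vV; apply: (mem_l u _ V) => // y yV.
rewrite skew_br -memvN opprK; apply: (mem_l y _ U) => // x xU.
rewrite skew_br -memvN opprK; apply: memv_span.
exact: allpairs_f.
Qed.

Lemma brv_sub (U V W : {vspace g}) :
  (forall u v, u \in U -> v \in V -> br u v \in W) -> (brv br U V <= W)%VS.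
Proof.
move=> UVW; apply/span_subvP => _ /allpairsP[[u v] /= [uU vV ->]].
by apply: UVW; apply: vbasis_mem.
Qed.

Definition is_ideal (W : {vspace g}) := forall x y, y \in W -> br x y \in W.

Section Quotient.
Variable W : {vspace g}.
Hypothesis idealW : is_ideal W.

Lemma quo_projP x : (quo_proj W x == 0) = (x \in W).
Proof. by rewrite -memv_ker lker_quo_proj. Qed.

Lemma quo_repr_mod x : quo_repr (quo_proj W x) - x \in W.
Proof. by rewrite -quo_projP linearB /= quo_reprK subrr. Qed.

Lemma quo_proj_bracket x y :
  quo_proj W (br x y) = quo_bracket br (quo_proj W x) (quo_proj W y).
Proof.
apply/eqP; rewrite eq_sym -subr_eq0 /quo_bracket -linearB quo_projP.
set x' := quo_repr _; set y' := quo_repr _.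
have -> : br x' y' - br x y = br x' (y' - y) - br y (x' - x).
  rewrite !(bilDr bil_br, bilNr bil_br) opprD opprK.
  by rewrite [br y x']skew_br [br y x]skew_br opprK -addrA addKr.
by rewrite memvB ?idealW ?quo_repr_mod.
Qed.

Lemma quo_bracket_lie : is_lie_bracket (quo_bracket br (W := W)).
Proof.
have brE p q :
  quo_bracket br p q = quo_proj W (br (quo_repr p) (quo_repr q)) by [].
case: lie_br => [[linl linr] alt jac]; split.
- by split=> [q|p] k u v; rewrite !brE /quo_repr linearP /= ?linl ?linr linearP.
- by move=> p; rewrite brE alt linear0.
move=> x y z; rewrite -[x]quo_reprK -[y]quo_reprK -[z]quo_reprK.
by rewrite -!quo_proj_bracket -!linearD jac linear0.
Qed.

End Quotient.

Lemma mem_desc_centralS k x y :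
  y \in desc_central br k -> br x y \in desc_central br k.+1.
Proof. by move=> yk; rewrite /= memv_brv ?memvf. Qed.

Lemma desc_central_subS k : (desc_central br k.+1 <= desc_central br k)%VS.
Proof.
elim: k => [|k IHk]; first exact: subvf.
apply: brv_sub => u v _ vk; apply: mem_desc_centralS.
exact: subvP IHk _ vk.
Qed.

Lemma desc_central_sub k l : (k <= l)%N ->
  (desc_central br l <= desc_central br k)%VS.
Proof.
move=> /subnKC<-; elim: (l - k)%N => [|m IHm]; first by rewrite addn0.
by rewrite addnS (subv_trans (desc_central_subS _)).
Qed.

Lemma desc_central_ideal k : is_ideal (desc_central br k).
Proof.
by move=> x y yk; apply/(subvP (desc_central_subS k))/mem_desc_centralS.
Qed.

(** The recursion of the derived central series without quotients. It includes
    [k = 0], where [der_central br 0 = 0] makes it the definition of the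
    center. *)
Lemma mem_der_centralS k : is_ideal (der_central br k) ->
  forall x, x \in der_central br k.+1 <-> forall y, br x y \in der_central br k.
Proof.
case: k => [_ x|k].
  split=> [/(centerP _ bil_br) x0 y|x0]; first by rewrite x0 mem0v.
  by apply/(centerP _ bil_br) => y; apply/eqP; rewrite -memv0; apply: x0.
set C := der_central br k.+1 => idealC x.
have -> : der_central br k.+2 =
  (quo_proj C @^-1: center (quo_bracket br (W := C)))%VS by [].
have bil_quo : bilinear_map (quo_bracket br (W := C)).
  by case: (quo_bracket_lie idealC).
rewrite -memv_preim; split=> [/(centerP _ bil_quo) x0 y|x0].
  by rewrite -quo_projP quo_proj_bracket // x0.
apply/(centerP _ bil_quo) => p; apply/eqP.
by rewrite -[p]quo_reprK -quo_proj_bracket // quo_projP.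
Qed.

Variable B : g -> g -> F.
Hypothesis metricB : invariant_metric br B.
Let formB : nondeg_symmetric_form B. Proof. by case: metricB. Qed.
Let bilB : bilinear_map (B : g -> g -> F^o). Proof. by case: formB. Qed.
Let symB x y : B x y = B y x. Proof. by case: formB. Qed.
Let invB x y z : B (br x y) z = B x (br y z). Proof. by case: metricB. Qed.

Lemma perp_ideal W : is_ideal W -> is_ideal (perp B W).
Proof.
move=> idealW x y /(perpP formB) yW; apply/(perpP formB) => w wW.
by rewrite skew_br (bilNl bilB) invB yW ?oppr0 // idealW.
Qed.

(** By induction: [x] is in [C_(k+1)] iff [[x, y]] is orthogonal to [g^k] for
    all [y], which by invariance means that [x] is orthogonal to the
    [[y, w]] with [w] in [g^k], and these span [g^(k+1)]. *)
Lemma der_central_perp k : der_central br k = perp B (desc_central br k).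
Proof.
elim: k => [|k IHk].
  apply/esym/eqP; rewrite -subv0; apply/subvP => x /(perpP formB) x0.
  rewrite memv0; apply/eqP; case: formB => _ _; apply=> y.
  by apply: x0; rewrite memvf.
have idealC : is_ideal (der_central br k).
  rewrite IHk; apply: perp_ideal; exact: desc_central_ideal.
apply/vspaceP => x.
apply/idP/(perpP formB) => [/(mem_der_centralS idealC) xC|x0].
  move=> w wk; rewrite symB.
  suff /subvP/(_ w wk)/(perpP formB)/(_ x (memv_line x)) :
    (desc_central br k.+1 <= perp B <[x]>)%VS by [].
  apply: brv_sub => u v _ vk; apply/(perpP formB) => _ /vlineP[c ->].
  have := xC u; rewrite IHk => /(perpP formB)/(_ v vk); rewrite invB symB.
  by rewrite (bilZr bilB) => ->; rewrite scaler0.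
apply/(mem_der_centralS idealC) => y; rewrite IHk; apply/(perpP formB) => v vk.
by rewrite invB x0 // mem_desc_centralS.
Qed.

Lemma der_central_ideal k : is_ideal (der_central br k).
Proof. rewrite der_central_perp; exact/perp_ideal/desc_central_ideal. Qed.

Lemma der_central_sub k l : (k <= l)%N ->
  (der_central br k <= der_central br l)%VS.
Proof. by move=> kl; rewrite !der_central_perp perpS // desc_central_sub. Qed.

(** [B [c, w] y = - B c [y, w]], and [[y, w]] lies in [g^(k+1)], the orthogonal
    of [C_(k+1)]. *)
Lemma bracket_der_desc k c w :
  c \in der_central br k.+1 -> w \in desc_central br k -> br c w = 0.
Proof.
rewrite der_central_perp => /(perpP formB) c0 wk.
case: formB => _ _; apply=> y; rewrite invB skew_br (bilNr bilB) c0 ?oppr0 //.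
exact: mem_desc_centralS.
Qed.

(** [[g^l, g^l] = 0] makes [[g, g^l]] orthogonal to [g^l], so
    [g^(l+1) <= C_l]; each further bracket with [g] lowers the index of [C] by
    one, down to [C_0 = 0]. *)
Lemma nilpotent_of_abelian_desc_central :
  has_abelian_desc_central_ideal br -> exists n, desc_central br n = 0%VS.
Proof.
move=> [l [_ abl]]; exists (l.+1 + l)%N.
have sub_lC : (desc_central br l.+1 <= der_central br l)%VS.
  apply: brv_sub => x u _ ul; rewrite der_central_perp.
  apply/(perpP formB) => v vl.
  have := memv_brv ul vl; rewrite abl memv0 invB => /eqP->.
  by rewrite (bil0r bilB).
have sub m : (m <= l)%N ->
    (desc_central br (l.+1 + m) <= der_central br (l - m))%VS.
  elim: m => [|m IHm] ml; first by rewrite addn0 subn0.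
  rewrite addnS; apply: brv_sub => x u _ um; rewrite skew_br memvN.
  have := subvP (IHm (ltnW ml)) u um; rewrite -(subnSK ml).
  by move/(mem_der_centralS (@der_central_ideal _)); apply.
by apply/eqP; rewrite -subv0; have := sub l (leqnn l); rewrite subnn.
Qed.

(** * The canonical ideals of a nilpotent quadratic algebra *)

Variable n : nat.
Hypothesis nil_n : desc_central br n = 0%VS.

Definition ideal_i : {vspace g} :=
  (\sum_(1 <= k < n.+1) (der_central br k :&: desc_central br k))%VS.

(** The same subspace as the intersection of the [C_k + g^k], see [ideal_jP]. In
    this form it is visibly abelian. *)
Definition ideal_j : {vspace g} :=
  (\sum_(k < n) (der_central br k.+1 :&: desc_central br k))%VS.

Lemma ideal_iP : is_ideal_i br ideal_i.
Proof.
move=> x; split=> [xI|[m]]; first by exists n.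
move: x; apply/subvP/subv_sum_nat => k k0 _.
have [kn|nk] := leqP k n.
  rewrite /ideal_i (bigD1_seq k) ?iota_uniq ?mem_index_iota ?k0 //=.
  exact: addvSl.
have := desc_central_sub (ltnW nk); rewrite nil_n subv0 => /eqP->.
by rewrite capv0 sub0v.
Qed.

(** A summand [C_(m+1) :&: g^m] lies in [C_k] for [m < k] and in [g^k]
    otherwise. Conversely, if [x = s + w] with [s] in the first [m] summands and
    [w] in [g^m], and also [x = c + w'] with [c] in [C_(m+1)] and [w'] in
    [g^(m+1)], then [w - w' = c - s] lies in the summand of index [m]; after
    [n] steps the remainder lies in [g^n = 0]. *)
Lemma ideal_jP : is_ideal_j br ideal_j.
Proof.
move=> x; split=> [xJ k k0|xC].
  move: x xJ; apply/subvP/subv_sumP => m _.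
  have [mk|km] := ltnP m k.
    rewrite (subv_trans (capvSl _ _)) //.
    by rewrite (subv_trans (der_central_sub mk)) ?addvSl.
  rewrite (subv_trans (capvSr _ _)) //.
  by rewrite (subv_trans (desc_central_sub km)) ?addvSr.
suff H m : x \in (\sum_(k < m) (der_central br k.+1 :&: desc_central br k) +
                  desc_central br m)%VS.
  by have := H n; rewrite nil_n addv0.
elim: m => [|m IHm]; first by rewrite big_ord0 add0v memvf.
have /memv_addP[c cC [w' w'D Ex]] := xC m.+1 isT.
have /memv_addP[s sS [w wD Ex']] := IHm.
have cs : c - s \in der_central br m.+1.
  rewrite memvB //; move: s sS {Ex'}; apply/subvP/subv_sumP => k _.
  by rewrite (subv_trans (capvSl _ _)) // der_central_sub // ltnW // ltnS.
have E : c - s = w - w'.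
  by apply/eqP; rewrite subr_eq addrAC eq_sym subr_eq [w + s]addrC -Ex -Ex'.
rewrite big_ord_recr /= -addvA Ex' memv_add // -(subrK w' w) memv_add //.
rewrite memv_cap -{1}E cs memvB //.
by apply: subvP (desc_central_subS m) _ _.
Qed.

(** Orthogonality exchanges [C_k] and [g^k], so that
    [(C_k :&: g^k)^perp = g^k + C_k]. *)
Lemma perp_ideal_i : perp B ideal_i = ideal_j.
Proof.
apply/vspaceP => x; apply/(perpP formB)/idP => [x0|/ideal_jP xC y].
  apply/ideal_jP => k k0.
  have -> : (der_central br k + desc_central br k)%VS =
            perp B (der_central br k :&: desc_central br k).
    by rewrite perp_cap // der_central_perp perpK // addvC.
  by apply/(perpP formB) => y yk; apply: x0; apply/ideal_iP; exists k;
    rewrite big_nat_recr //= (subvP (addvSr _ _)).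
rewrite symB; move: y; suff /subvP sub : (ideal_i <= perp B <[x]>)%VS.
  by move=> y /sub/(perpP formB)/(_ x (memv_line x)).
apply: subv_sum_nat => k k0 _; apply/subvP => y.
rewrite memv_cap => /andP[yC yD]; apply/(perpP formB) => _ /vlineP[c ->].
rewrite symB (bilZl bilB); have /memv_addP[c' c'C [d dD ->]] := xC k k0.
move: yC c'C; rewrite !der_central_perp => /(perpP formB) y0 /(perpP formB) c0.
by rewrite (bilDl bilB) c0 // symB y0 // addr0 scaler0.
Qed.

Lemma ideal_i_sub_j : (ideal_i <= ideal_j)%VS.
Proof.
apply: subv_sum_nat => k k0 _; apply/subvP => x.
rewrite memv_cap => /andP[xC xD]; apply/ideal_jP => m _.
have [km|mk] := leqP k m.
  by apply: (subvP (addvSl _ _)); apply: (subvP (der_central_sub km)).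
by apply: (subvP (addvSr _ _)); apply: (subvP (desc_central_sub (ltnW mk))).
Qed.

Lemma ideal_j_ideal : is_ideal ideal_j.
Proof.
move=> x y /ideal_jP yJ; apply/ideal_jP => k k0.
have /memv_addP[c cC [d dD ->]] := yJ k k0.
by rewrite (bilDr bil_br) memv_add ?der_central_ideal ?desc_central_ideal.
Qed.

(** For [m <= k], [[C_(k+1) :&: g^k, C_(m+1) :&: g^m]] is contained in
    [[g^m, C_(m+1)] = 0]. *)
Lemma ideal_j_abelian x y : x \in ideal_j -> y \in ideal_j -> br x y = 0.
Proof.
have brC k m u v : (m <= k)%N ->
    u \in (der_central br k.+1 :&: desc_central br k)%VS ->
    v \in (der_central br m.+1 :&: desc_central br m)%VS -> br u v = 0.
  rewrite !memv_cap => mk /andP[_ uD] /andP[vC _].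
  rewrite skew_br (bracket_der_desc vC) ?oppr0 //.
  exact: (subvP (desc_central_sub mk)).
move=> /memv_sumP[u uP ->] /memv_sumP[v vP ->].
have adE w z : linfun (br w) z = br w z := linfunE (proj2 bil_br w) z.
rewrite skew_br -adE linear_sum big1 ?oppr0 // => i _.
rewrite /= adE skew_br -adE linear_sum big1 ?oppr0 // => j _; rewrite /= adE.
have [ij|ji] := leqP i j; last by rewrite (brC i j) ?uP ?vP // ltnW.
by rewrite skew_br (brC j i) ?oppr0 ?uP ?vP.
Qed.

End Brackets.

(** * Splitting along an abelian ideal containing its orthogonal *)

Section Splitting.
Variables (F : fieldType) (g : vectType F) (br : g -> g -> g) (B : g -> g -> F).
Variable J : {vspace g}.

Local Notation h := (quo J).
Local Notation pr := (quo_proj J).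
Local Notation h_dual := 'Hom(h, F^o).

(** A functional on [g / J] is one on [g] that vanishes on [J], hence is
    represented by a vector of [perp B J]. *)
Definition dual_embed : 'Hom(h_dual, g) :=
  linfun (fun al => sharp B (al \o pr)%VF).

(** The correction by half of the Gram form of the complement makes the image
    isotropic: [B (dual_embed al)] restricts to [al] on the complement, so each
    of the two corrections in [B (iso_section x) (iso_section y)] removes half
    of the form. *)
Definition iso_section : 'Hom(h, g) :=
  linfun (fun x => quo_repr x -
    2^-1 *: dual_embed (flat B (quo_repr x) \o linfun (@quo_repr F g J))%VF).

(** The copy of [a] in [g]. *)
Definition middle : {vspace g} := (J :&: perp B (limg iso_section))%VS.

Local Notation a := (subvs_of middle).

(** [(quo_proj J z, middle_coord z, dual_coord z)] are the coordinates of [z] in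
    the decomposition of [g]; [recompose] is the inverse of this map. *)
Definition dual_coord : 'Hom(g, h_dual) :=
  linfun (fun z => (flat B z \o iso_section)%VF).

Definition middle_coord : 'Hom(g, a) :=
  linfun (fun z =>
    vsproj middle (z - iso_section (pr z) - dual_embed (dual_coord z))).

Definition recompose : 'Hom((h * a * h_dual)%type, g) :=
  linfun (fun p : h * a * h_dual =>
    iso_section p.1.1 + vsval p.1.2 + dual_embed p.2).

Definition middle_form (u v : a) : F := B (vsval u) (vsval v).

Definition split_phi : 'Hom(h, 'Hom(a, h_dual)) :=
  linfun (fun x => linfun (fun u : a =>
    dual_coord (br (iso_section x) (vsval u)))).

Definition split_lam (t : 2.-tuple h) : a :=
  middle_coord (br (iso_section (tnth t ord0)) (iso_section (tnth t ord_max))).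

Definition split_mu (t : 2.-tuple h) : h_dual :=
  dual_coord (br (iso_section (tnth t ord0)) (iso_section (tnth t ord_max))).

Hypothesis char0 : [pchar F] =i pred0.
Hypothesis quadB : quadratic_lie_algebra br B.
Hypothesis idealJ : is_ideal br J.
Hypothesis abelianJ : forall x y, x \in J -> y \in J -> br x y = 0.
Hypothesis perpJ : (perp B J <= J)%VS.

Let lie_br : is_lie_bracket br. Proof. by case: quadB. Qed.
Let formB : nondeg_symmetric_form B. Proof. by case: quadB => _ []. Qed.
Let bil_br : bilinear_map br. Proof. by case: lie_br. Qed.
Let bilB : bilinear_map (B : g -> g -> F^o). Proof. by case: formB. Qed.
Let symB x y : B x y = B y x. Proof. by case: formB. Qed.
Let invB x y z : B (br x y) z = B x (br y z).
Proof. by case: quadB => _ []. Qed.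
Let skew_br x y : br x y = - br y x.
Proof. by case: lie_br => bl al _; apply: (alternating_skew bl al). Qed.

Let BDl x y z : B (x + y) z = B x z + B y z. Proof. exact: (bilDl bilB). Qed.
Let BDr x y z : B x (y + z) = B x y + B x z. Proof. exact: (bilDr bilB). Qed.
Let BNl x z : B (- x) z = - B x z. Proof. exact: (bilNl bilB). Qed.
Let BNr x z : B x (- z) = - B x z. Proof. exact: (bilNr bilB). Qed.
Let BZl k x z : B (k *: x) z = k * B x z. Proof. exact: (bilZl bilB). Qed.
Let BZr k x z : B x (k *: z) = k * B x z. Proof. exact: (bilZr bilB). Qed.

Let two_neq0 : 2 != 0 :> F. Proof. by rewrite ((pcharf0P F).1 char0). Qed.

Lemma dual_embedE al z : B (dual_embed al) z = al (pr z).
Proof.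
rewrite linfunE ?(sharpE formB) ?comp_lfunE // => k u v.
by rewrite comp_lfunDl -comp_lfunZl /sharp linearP.
Qed.

Lemma dual_embed_perp al : dual_embed al \in perp B J.
Proof.
apply/(perpP formB) => w; rewrite dual_embedE -quo_projP.
by move/eqP->; rewrite linear0.
Qed.

Lemma dual_embed_J al : dual_embed al \in J.
Proof. exact: subvP perpJ _ (dual_embed_perp al). Qed.

Lemma quo_proj_J w : w \in J -> pr w = 0.
Proof. by rewrite -quo_projP => /eqP. Qed.

Let quo_repr_linear : linear (@quo_repr F g J).
Proof. by move=> k x y; rewrite /quo_repr linearP. Qed.

Lemma iso_sectionE x : iso_section x = quo_repr x -
  2^-1 *: dual_embed (flat B (quo_repr x) \o linfun (@quo_repr F g J))%VF.
Proof.
apply: linfunE => k {}x y.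
rewrite !quo_repr_linear linearP comp_lfunDl -comp_lfunZl.
rewrite linearP scalerDr scalerA mulrC -scalerA opprD.
by rewrite addrACA -scalerN -scalerDr.
Qed.

Lemma quo_proj_section x : pr (iso_section x) = x.
Proof.
rewrite iso_sectionE linearB linearZ /= quo_reprK quo_proj_J ?scaler0 ?subr0 //.
exact: dual_embed_J.
Qed.

Lemma form_dual_section al y : B (dual_embed al) (iso_section y) = al y.
Proof. by rewrite dual_embedE quo_proj_section. Qed.

Lemma form_J_dual w al : w \in J -> B w (dual_embed al) = 0.
Proof. by move=> wJ; rewrite symB dual_embedE quo_proj_J ?linear0. Qed.

Lemma section_isotropic x y : B (iso_section x) (iso_section y) = 0.
Proof.
rewrite [iso_section y]iso_sectionE BDr BNr BZr symB.
rewrite [B (iso_section x) (dual_embed _)]symB form_dual_section comp_lfunE.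
rewrite (linfunE quo_repr_linear) (flatE formB).
rewrite iso_sectionE BDr BNr BZr [B _ (dual_embed _)]symB dual_embedE quo_reprK.
rewrite comp_lfunE (linfunE quo_repr_linear) (flatE formB).
rewrite [B (quo_repr x) _]symB.
by apply: (mulfI two_neq0); field.
Qed.

Lemma dual_coordE z y : dual_coord z y = B z (iso_section y).
Proof.
rewrite linfunE ?comp_lfunE ?(flatE formB) // => k u v.
by rewrite linearP comp_lfunDl -comp_lfunZl.
Qed.

Lemma middleP z :
  reflect (z \in J /\ forall y, B z (iso_section y) = 0) (z \in middle).
Proof.
rewrite memv_cap.
apply: (iffP andP) => [[zJ /(perpP formB) z0]|[zJ z0]]; split=> //.
  by move=> y; apply: z0; rewrite memv_img ?memvf.
apply/(perpP formB) => _ /memv_imgP[y _ ->]; apply: z0.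
Qed.

Lemma middle_coordE z : vsval (middle_coord z) =
  z - iso_section (pr z) - dual_embed (dual_coord z).
Proof.
have alg k (u u' s s' d d' : g) :
    k *: u + u' - (k *: s + s') - (k *: d + d') =
    k *: (u - s - d) + (u' - s' - d').
  rewrite !opprD !scalerDr !scalerN.
  by rewrite [X in X + _ = _]addrACA [LHS]addrACA.
rewrite linfunE => [|k u v]; last first.
  rewrite [pr _]linearP [iso_section _]linearP [dual_coord _]linearP.
  by rewrite [dual_embed _]linearP alg linearP.
rewrite vsprojK //; apply/middleP; split=> [|y].
  rewrite memvB ?dual_embed_J // -quo_projP linearB /=.
  by rewrite quo_proj_section subrr.
rewrite !BDl !BNl section_isotropic form_dual_section dual_coordE.
by rewrite oppr0 addr0 subrr.
Qed.

Lemma recomposeE p :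
  recompose p = iso_section p.1.1 + vsval p.1.2 + dual_embed p.2.
Proof.
have alg k (x x' u u' d d' : g) :
    k *: x + x' + (k *: u + u') + (k *: d + d') =
    k *: (x + u + d) + (x' + u' + d').
  by rewrite !scalerDr [X in X + _ = _]addrACA [LHS]addrACA.
by apply: linfunE => k q r; rewrite !linearP alg.
Qed.

Lemma recompose_coord z : recompose (pr z, middle_coord z, dual_coord z) = z.
Proof.
rewrite recomposeE /= middle_coordE addrA subrK.
by rewrite addrC subrK.
Qed.

Let valJ (u : a) : vsval u \in J. Proof. by case/middleP: (subvsP u). Qed.
Let val_section (u : a) y : B (vsval u) (iso_section y) = 0.
Proof. by case/middleP: (subvsP u). Qed.

Lemma recompose_isometry p q :
  B (recompose p) (recompose q) = ext_form middle_form p q.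
Proof.
rewrite (ext_formE middle_form) !recomposeE !BDl !BDr.
rewrite section_isotropic val_section.
rewrite [B (iso_section _) (vsval _)]symB val_section form_dual_section.
rewrite [B (iso_section _) _]symB form_dual_section.
rewrite [B (dual_embed _) (vsval _)]symB !form_J_dual ?dual_embed_J //.
rewrite /middle_form; ring.
Qed.

Lemma quo_proj_recompose p : pr (recompose p) = p.1.1.
Proof.
rewrite recomposeE !linearD /= quo_proj_section !quo_proj_J ?dual_embed_J //.
by rewrite !addr0.
Qed.

Lemma dual_coord_recompose p : dual_coord (recompose p) = p.2.
Proof.
apply/lfunP => y; rewrite dual_coordE recomposeE !BDl section_isotropic.
by rewrite val_section form_dual_section !add0r.
Qed.

Lemma middle_coord_recompose p : middle_coord (recompose p) = p.1.2.
Proof.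
apply: val_inj; rewrite /= middle_coordE.
rewrite quo_proj_recompose dual_coord_recompose.
by rewrite recomposeE addrAC addrK addrC addKr.
Qed.

Lemma recompose_bij : bijective recompose.
Proof.
exists (fun z => (pr z, middle_coord z, dual_coord z)) => [[[x u] al]|].
  rewrite quo_proj_recompose dual_coord_recompose.
  by rewrite middle_coord_recompose.
exact: recompose_coord.
Qed.

Lemma middle_form_nondeg : nondeg_symmetric_form middle_form.
Proof.
split=> [|u v|u u0]; last 1 first.
- apply: val_inj; rewrite linear0; case: formB => _ _; apply=> z.
  rewrite -(recompose_coord z) recomposeE !BDr val_section.
  rewrite form_J_dual; last exact: valJ.
  by have := u0 (middle_coord z); rewrite /middle_form => ->; rewrite !addr0.
- split=> [v|u] k w z; rewrite /middle_form linearP /=.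
    by rewrite BDl BZl.
  by rewrite BDr BZr.
- exact: symB.
Qed.

Lemma form_middle_coord z (v : a) :
  B z (vsval v) = middle_form (middle_coord z) v.
Proof.
rewrite -{1}(recompose_coord z) recomposeE !BDl.
rewrite [B (iso_section _) _]symB val_section.
by rewrite [B (dual_embed _) _]symB form_J_dual // add0r addr0.
Qed.

Lemma middle_coord_eq z z' :
  (forall v : a, B z (vsval v) = B z' (vsval v)) ->
  middle_coord z = middle_coord z'.
Proof.
move=> eq_zz'; apply/eqP; rewrite -subr_eq0; apply/eqP.
case: middle_form_nondeg => bilm _; apply=> v.
by rewrite (bilDl bilm) (bilNl bilm) -!form_middle_coord eq_zz' subrr.
Qed.

Lemma split_phiE x (u : a) :
  split_phi x u = dual_coord (br (iso_section x) (vsval u)).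
Proof.
have lin_u y :
    linear (fun u : a => dual_coord (br (iso_section y) (vsval u))).
  by move=> k v w; rewrite linearP (proj2 bil_br) linearP.
rewrite /split_phi linfunE; first exact: linfunE (lin_u x) u.
move=> k y z; apply/lfunP => v.
rewrite add_lfunE scale_lfunE !(linfunE (lin_u _)) [iso_section _]linearP.
by rewrite (proj1 bil_br) linearP.
Qed.

Lemma split_lam_cochain : is_cochain split_lam.
Proof.
apply/cochain2P; split=> [|x]; last first.
  rewrite /split_lam; case: lie_br => _ -> _.
  exact: linear0.
split=> [y|x] k u v; rewrite /split_lam !(tnth_nth 0) /= linearP.
  by rewrite (proj1 bil_br) linearP.
by rewrite (proj2 bil_br) linearP.
Qed.

Lemma split_mu_cochain : is_cochain split_mu.
Proof.
apply/cochain2P; split=> [|x]; last first.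
  rewrite /split_mu; case: lie_br => _ -> _.
  by apply/lfunP => y; rewrite dual_coordE (bil0l bilB) zero_lfunE.
split=> [y|x] k u v; rewrite /split_mu !(tnth_nth 0) /= linearP.
  by rewrite (proj1 bil_br) linearP.
by rewrite (proj2 bil_br) linearP.
Qed.

Local Notation brh := (quo_bracket br (W := J)).
Local Notation ext := (ext_bracket brh split_phi split_lam split_mu).

Let lie_h : is_lie_bracket brh. Proof. exact: quo_bracket_lie. Qed.

(** Compare coordinates. Modulo [J] this is the bracket of [h]. The [a]-part is
    seen by pairing with [v] in the middle, and [B [z, w] v = B z [w, v] = 0]
    for [w] in [J] because [J] is abelian, so only the two sections contribute.
    The [h^*]-part is seen by pairing with the section. *)
Lemma recompose_bracket p q :
  recompose (ext p q) = br (recompose p) (recompose q).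
Proof.
set z := br _ _; rewrite -[RHS]recompose_coord; congr (recompose _).
(* [w r] is the J-part of [r], kept opaque. *)
have [w wE] : exists w, forall r : h * a * h_dual,
    w r = vsval r.1.2 + dual_embed r.2 by eexists.
have wJ r : w r \in J by rewrite wE memvD ?valJ ?dual_embed_J.
have sE r : recompose r = iso_section r.1.1 + w r.
  by rewrite wE recomposeE addrA.
have zE : z = br (iso_section p.1.1) (iso_section q.1.1) +
    br (iso_section p.1.1) (w q) - br (iso_section q.1.1) (w p).
  rewrite /z !sE !(bilDl bil_br) !(bilDr bil_br).
  by rewrite [br (w p) (w q)]abelianJ // addr0 [br (w p) _]skew_br.
apply: triple_eq => [||t].
- rewrite ext_bracket1E /= /z quo_proj_bracket //.
  by rewrite !quo_proj_recompose.
- rewrite ext_bracket1E /= /split_lam; apply: middle_coord_eq => v.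
  rewrite !(tnth_nth 0) /= zE !BDl BNl !invB.
  by rewrite ![br (w _) _]abelianJ // !(bil0r bilB) oppr0 !addr0.
rewrite (ext_bracket2E _ _ _ lie_h) /= !split_phiE !dual_coordE.
rewrite !(tnth_nth 0) /= zE !BDl BNl.
rewrite !wE !(bilDr bil_br) !BDl.
have coadE' x al :
    B (br (iso_section x) (dual_embed al)) (iso_section t) = - al (brh x t).
  rewrite skew_br BNl invB dual_embedE quo_proj_bracket //.
  by rewrite !quo_proj_section.
rewrite !coadE'; ring.
Qed.

Lemma split_ext_lie : is_lie_bracket ext.
Proof.
have [bil_ext alt_ext] := ext_bracket_bilinear_alternating split_phi lie_h
  split_lam_cochain split_mu_cochain.
split=> // p q r; apply: (bij_inj recompose_bij).
by rewrite !linearD /= !recompose_bracket linear0; case: lie_br.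
Qed.

Lemma recompose_iso : is_lie_iso ext br recompose.
Proof. by split; [exact: recompose_bij | exact: recompose_bracket]. Qed.

Lemma mem_J_recompose z :
  z \in J <-> exists u al, z = recompose (0, u, al).
Proof.
split=> [zJ|[u [al ->]]].
  exists (middle_coord z), (dual_coord z).
  by rewrite -{1}(recompose_coord z) quo_proj_J.
rewrite -quo_projP; apply/eqP; exact: quo_proj_recompose.
Qed.

Lemma mem_perpJ_recompose z :
  z \in perp B J <-> exists al, z = recompose (0, 0, al).
Proof.
have recE al : recompose (0, 0, al) = dual_embed al.
  by rewrite recomposeE /= !linear0 !add0r.
split=> [zJ|[al ->]]; last by rewrite recE dual_embed_perp.
exists (dual_coord z); rewrite -{1}(recompose_coord z).
rewrite quo_proj_J ?(subvP perpJ) // (_ : middle_coord z = 0) //.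
case: middle_form_nondeg => _ _; apply=> v; rewrite -form_middle_coord.
by move: zJ => /(perpP formB) ->.
Qed.

Lemma split_components x y :
  let w := (recompose^-1)%VF (br (recompose (x, 0, 0)) (recompose (y, 0, 0))) in
  split_lam [tuple x; y] = w.1.2 /\ split_mu [tuple x; y] = w.2.
Proof.
rewrite -recompose_bracket lker0_lfunK.
  by rewrite /= !linear0 !addr0.
by apply/lker0P; apply: bij_inj recompose_bij.
Qed.

End Splitting.

(** * The theorem *)
Theorem theorem3p1 (F : fieldType) (char0 : [pchar F] =i pred0) :
  (forall (h a : vectType F) (brh : h -> h -> h)
      (phi : 'Hom(h, 'Hom(a, 'Hom(h, F^o))))
      (lam : 2.-tuple h -> a) (mu : 2.-tuple h -> 'Hom(h, F^o)),
    is_lie_bracket brh -> is_1cocycle brh phi ->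
    is_cochain lam -> is_cochain mu ->
    is_lie_bracket (ext_bracket brh phi lam mu) <->
      in_Ker_D_phi brh phi lam mu)
  /\
  (forall (h a : vectType F) (brh : h -> h -> h)
      (phi : 'Hom(h, 'Hom(a, 'Hom(h, F^o))))
      (lam : 2.-tuple h -> a) (mu : 2.-tuple h -> 'Hom(h, F^o))
      (Ba : a -> a -> F) (lam_phi : h -> h -> a),
    is_lie_bracket brh -> is_1cocycle brh phi ->
    is_cochain lam -> is_cochain mu ->
    is_lie_bracket (ext_bracket brh phi lam mu) ->
    nondeg_symmetric_form Ba ->
    bilinear_map lam_phi ->
    (forall x y v, phi_star phi x y v = - Ba (lam_phi x y) v) ->
    let b1 := forall x y z, mu [tuple x; y] z = mu [tuple y; z] x in
    let b2 := exists tau : 'Hom(h, a),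
      in_Ker_e_phi phi (cochain1 tau) /\
      (forall x y, lam_phi x y =
         lam [tuple x; y] +
         ce_d brh (@triv_act F h a) (cochain1 tau) [tuple x; y]) in
    (quadratic_lie_algebra (ext_bracket brh phi lam mu) (ext_form Ba) ->
       b1 /\ b2) /\
    (b1 /\ b2 ->
       exists B, invariant_metric (ext_bracket brh phi lam mu) B))
  /\
  (forall (g : vectType F) (br : g -> g -> g) (B : g -> g -> F),
    quadratic_lie_algebra br B ->
    solvable_lie br -> ~ abelian_lie br ->
    has_abelian_desc_central_ideal br ->
    exists I J : {vspace g}, is_ideal_i br I /\ is_ideal_j br J /\
    exists (h a : vectType F) (brh : h -> h -> h) (Ba : a -> a -> F)
      (phi : 'Hom(h, 'Hom(a, 'Hom(h, F^o))))
      (lam : 2.-tuple h -> a) (mu : 2.-tuple h -> 'Hom(h, F^o))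
      (Psi : 'Hom((h * a * 'Hom(h, F^o))%type, g)),
      is_lie_bracket brh /\
      (exists theta : 'Hom(h, quo J),
         is_lie_iso brh (quo_bracket br (W := J)) theta) /\
      nondeg_symmetric_form Ba /\
      is_1cocycle brh phi /\
      in_Ker_D_phi brh phi lam mu /\
      (* Psi is an isometric isomorphism of Lie algebras onto g *)
      is_lie_iso (ext_bracket brh phi lam mu) br Psi /\
      (forall p q, B (Psi p) (Psi q) = ext_form Ba p q) /\
      (* it maps h^* onto i(g) and a + h^* onto j(g) *)
      (forall z, z \in I <-> exists al, z = Psi (0, 0, al)) /\
      (forall z, z \in J <-> exists u al, z = Psi (0, u, al)) /\
      (* lam and mu are the a- and h^*-components of the bracket on h *)
      (forall x y,
         let w := (Psi^-1)%VF (br (Psi (x, 0, 0)) (Psi (y, 0, 0))) in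
         lam [tuple x; y] = w.1.2 /\ mu [tuple x; y] = w.2)).
Proof.
split; [|split].
- move=> h a brh phi lam mu lie_h phiP lamP muP.
  exact: is_lie_ext_bracketP.
- move=> h a brh phi lam mu Ba lam_phi lie_h phiP lamP muP lie_ext Ba_form.
  move=> bil_lam_phi lam_phiE b1 b2.
  have d_tau (tau : 'Hom(h, a)) x y :
      ce_d brh (@triv_act F h a) (cochain1 tau) [tuple x; y] = - tau (brh x y).
    by rewrite ce_d_deg1 /triv_act subrr add0r /cochain1 (tnth_nth 0).
  split=> [[_ [_ invB]]|[mu_cyc [tau [[_ e_tau] lam_tau]]]].
    split=> [x y z|].
      exact: (mu_cyclic_of_invariant lie_h Ba_form invB).
    exists 0; split.
      split=> [|x]; first by split=> [x i k u v|x i j _ _];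
        rewrite /cochain1 !zero_lfunE ?scaler0 ?addr0.
      rewrite /e_phi big1 // => i _.
      by rewrite /cochain1 zero_lfunE linear0 scaler0.
    move=> x y; rewrite d_tau zero_lfunE subr0.
    exact: (lam_phi_of_invariant lie_h lamP muP Ba_form lam_phiE invB).
  exists (twisted_form Ba tau); split; first exact: twisted_form_nondeg.
  apply: (twisted_form_invariant char0 lie_h lamP Ba_form lam_phiE) => // x y.
    have := e_tau [tuple x; y].
    rewrite e_phi_deg1 /cochain1 !(tnth_nth 0) => /eqP.
    by rewrite subr_eq0 => /eqP.
  by rewrite lam_tau d_tau.
move=> g br B quadB _ _ abl; have [lie_br metricB] := quadB.
have [n nil_n] := nilpotent_of_abelian_desc_central lie_br metricB abl.
have [formB _] := metricB.
pose J := ideal_j br n.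
have perpJ : perp B J = ideal_i br n.
  by rewrite /J -(perp_ideal_i lie_br metricB nil_n) perpK.
have subJ : (perp B J <= J)%VS.
  by rewrite perpJ; exact: (ideal_i_sub_j lie_br metricB nil_n).
have idJ : is_ideal br J := ideal_j_ideal lie_br metricB nil_n.
have ablJ x y : x \in J -> y \in J -> br x y = 0.
  exact: (ideal_j_abelian lie_br metricB).
exists (ideal_i br n), J; split; first exact: ideal_iP.
split; first exact: (ideal_jP lie_br metricB nil_n).
exists (quo J), (subvs_of (middle B J)), (quo_bracket br (W := J)).
exists (@middle_form _ _ B J), (split_phi br B J), (@split_lam _ _ br B J).
exists (@split_mu _ _ br B J), (recompose B J).
have lie_h := quo_bracket_lie lie_br idJ.
have lie_ext := split_ext_lie char0 quadB idJ ablJ subJ.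
have lamP := split_lam_cochain J quadB.
have muP := split_mu_cochain J quadB.
have phiP := is_1cocycle_ext lie_h lamP muP lie_ext.
split; first exact: lie_h.
split.
  exists \1%VF; split; first by exists id => x; rewrite id_lfunE.
  by move=> x y; rewrite !id_lfunE.
split; first exact: (middle_form_nondeg char0 quadB subJ).
split; first exact: phiP.
split; first by apply/is_lie_ext_bracketP.
split; first exact: (recompose_iso char0 quadB idJ ablJ subJ).
split; first exact: (recompose_isometry char0 quadB subJ).
split.
  by rewrite -perpJ => z; apply: (mem_perpJ_recompose char0 quadB subJ).
split; first by move=> z; apply: (mem_J_recompose char0 quadB subJ).
exact: (split_components char0 quadB idJ ablJ subJ).
Qed.
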